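(* Let $n\ge1$ be an integer and $q\in(0,1)$. The antipodal $\mathbb{Z}/2$-action on the odd quantum sphere $C(S^{2n-1}_q)$ satisfies $\mathrm{dim}^{\mathbb{Z}/2}_{\mathrm{LT}}(C(S^{2n-1}_q))\le2n-1$.
   Context: $C(S^{2n-1}_q)$ (Vaksman--Soibelman quantum sphere) is the universal $C^*$-algebra generated by $z_1,\ldots,z_n$ subject to: $z_jz_i=q\,z_iz_j$ for $i<j$; $z_j^*z_i=q\,z_iz_j^*$ for $i\ne j$; $z_i^*z_i=z_iz_i^*+(1-q^2)\sum_{j>i}z_jz_j^*$ for all $i$; and $z_1z_1^*+\cdots+z_nz_n^*=1$. The antipodal $\mathbb{Z}/2$-action is generated by $z_j\mapsto-z_j$ for all $j$. (By Hong--Szymański, $C(S^{2n-1}_q)$ is isomorphic to the graph $C^*$-algebra of the graph with vertices $v_1,\ldots,v_n$ and one edge $e_{ij}$ from $v_i$ to $v_j$ for all $1\le i\le j\le n$, and the antipodal action corresponds to the restriction of the gauge action to $\mathbb{Z}/2$, i.e. edge partial isometries $S_e\mapsto-S_e$ and vertex projections fixed.) Local-triviality dimension: let a compact group $G$ act on a unital $C^*$-algebra $A$. Equip $C(G)$ with $(\alpha_gf)(h)=f(hg)$ and $C_0((0,1])\otimes C(G)$ with the action on the second factor, and let $t$ be the identity function in $C_0((0,1])$. $\mathrm{dim}^G_{\mathrm{LT}}(A)$ is the smallest $m\ge0$ for which there exist $G$-equivariant $*$-homomorphisms $\rho_0,\ldots,\rho_m:C_0((0,1])\otimes C(G)\to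 A$ with $\sum_{i=0}^m\rho_i(t\otimes1)=1$ ($\infty$ if no such $m$ exists). *)

(* Defs.v *)
From HB Require Import structures.
From mathcomp Require Import all_boot all_order all_algebra all_fingroup.
From mathcomp Require Export complex.
From mathcomp Require Import all_classical all_reals all_analysis.

Set Implicit Arguments.
Unset Strict Implicit.
Unset Printing Implicit Defensive.

Import Order.TTheory GRing.Theory Num.Theory numFieldNormedType.Exports.
Local Open Scope classical_set_scope.
Local Open Scope complex_scope.
Local Open Scope ring_scope.

(* Unital C*-algebras. Hierarchy-Builder cannot join MathComp's rings with its
   normed modules (a NumDomain is already both, over itself), so the complete
   norm is given here directly, with values in R. As for all MathComp algebras,
   1 != 0 is part of the structure, so the zero algebra is excluded. *)
HB.mixin Record isCStarAlgebra (R : realType) A of GRing.Algebra R[i] A := {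
  star : A -> A;
  cnorm : A -> R;
  starD : forall x y : A, star (x + y) = star x + star y;
  starZ : forall (c : R[i]) (x : A), star (c *: x) = c^* *: star x;
  starM : forall x y : A, star (x * y) = star y * star x;
  starK : forall x : A, star (star x) = x;
  cnorm_eq0 : forall x : A, cnorm x = 0 -> x = 0;
  cnormD : forall x y : A, cnorm (x + y) <= cnorm x + cnorm y;
  cnormZ : forall (c : R[i]) (x : A),
    (cnorm (c *: x))%:C = `|c| * (cnorm x)%:C;
  cnormM : forall x y : A, cnorm (x * y) <= cnorm x * cnorm y;
  cnorm_starM : forall x : A, cnorm (star x * x) = cnorm x ^+ 2;
  cnorm_complete : forall u : nat -> A,
    (forall e : R, 0 < e -> exists N : nat, forall k l : nat,
       (N <= k)%N -> (N <= l)%N -> cnorm (u k - u l) < e) ->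
    exists x : A, forall e : R, 0 < e -> exists N : nat, forall k : nat,
       (N <= k)%N -> cnorm (u k - x) < e
}.

#[short(type="cstarAlgType")]
HB.structure Definition CStarAlgebra (R : realType) :=
  {A of isCStarAlgebra R A & GRing.Algebra R[i] A}.

(* Unital *-homomorphisms are the {lrmorphism A -> B} with this property;
   they are automatically contractive. *)
Definition star_preserving (R : realType) (A B : cstarAlgType R)
  (phi : A -> B) : Prop := forall x, phi (star x) = star (phi x).

(* Discrete groups only, so there is no continuity requirement. *)
Record cstar_action (R : realType) (G : finGroupType) (A : cstarAlgType R) :=
  CStarAction {
    act_fun :> G -> {lrmorphism A -> A};
    act_star : forall g, star_preserving (act_fun g);
    act_one : forall x, act_fun 1%g x = x;
    act_mul : forall g h x, act_fun (g * h)%g x = act_fun g (act_fun h x) }.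

Section VaksmanSoibelman.
Variables (R : realType) (n : nat) (q : R).

(* The index i : 'I_n stands for the generator z_(i+1). *)
Record sphere_relations (A : cstarAlgType R) (z : 'I_n -> A) : Prop :=
  SphereRelations {
    sphere_zz : forall i j : 'I_n, (i < j)%N ->
      z j * z i = q%:C *: (z i * z j);
    sphere_starz : forall i j : 'I_n, i != j ->
      star (z j) * z i = q%:C *: (z i * star (z j));
    sphere_starzz : forall i : 'I_n,
      star (z i) * z i = z i * star (z i)
        + (1 - q ^+ 2)%:C *: \sum_(j < n | (i < j)%N) z j * star (z j);
    sphere_sum : \sum_(i < n) z i * star (z i) = 1 }.

(* (A, z) is the universal C*-algebra C(S_q^(2n-1)) with its generators. *)
Definition is_quantum_sphere (A : cstarAlgType R) (z : 'I_n -> A) : Prop :=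
  sphere_relations z /\
  forall (B : cstarAlgType R) (w : 'I_n -> B), sphere_relations w ->
    exists phi : {lrmorphism A -> B},
      [/\ star_preserving phi,
          forall i, phi (z i) = w i
        & forall psi : {lrmorphism A -> B}, star_preserving psi ->
            (forall i, psi (z i) = w i) -> psi =1 phi].

(* 'Z_2 is additive; (1 : 'Z_2) is its generator. *)
Definition is_antipodal (A : cstarAlgType R) (z : 'I_n -> A)
    (alpha : cstar_action 'Z_2 A) : Prop :=
  forall j, alpha (1%R : 'Z_2) (z j) = - z j.

End VaksmanSoibelman.

Definition C0 (R : realType) (X : topologicalType) (f : X -> R[i]) : Prop :=
  continuous (f : X -> R[i]^o) /\
  forall e : R, 0 < e ->
    exists2 K : set X, compact K & forall x, ~ K x -> `|f x| < e%:C.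

Section LocalTrivialityDimension.
Variables (R : realType) (G : finGroupType).

Definition half_open_interval : topologicalType :=
  set_type (`]0, 1] : set R).

(* G is finite, so C(G) is the algebra of all functions G -> R[i] and
   C_0((0,1]) (x) C(G) is the algebra of the functions F of t in (0,1] and
   g in G with all F(., g) in C_0((0,1]); f (x) h is (t, g) |-> f t * h g. *)
Definition cone_fun := half_open_interval -> G -> R[i].

Definition in_cone (F : cone_fun) : Prop :=
  forall g : G, C0 (fun t : half_open_interval => F t g).

Definition cone_translate (g : G) (F : cone_fun) : cone_fun :=
  fun t h => F t (h * g)%g.

Definition cone_t1 : cone_fun := fun t _ => (set_val t)%:C.

Variable A : cstarAlgType R.

(* G-equivariant (non-unital) *-homomorphisms from the cone to A; the values
   of rho outside in_cone are irrelevant. *)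
Record equivariant_cone_hom (alpha : cstar_action G A) (rho : cone_fun -> A)
  : Prop := EquivariantConeHom {
    cone_homD : forall F H, in_cone F -> in_cone H ->
      rho (fun t g => F t g + H t g) = rho F + rho H;
    cone_homZ : forall (c : R[i]) F, in_cone F ->
      rho (fun t g => c * F t g) = c *: rho F;
    cone_homM : forall F H, in_cone F -> in_cone H ->
      rho (fun t g => F t g * H t g) = rho F * rho H;
    cone_hom_star : forall F, in_cone F ->
      rho (fun t g => (F t g)^*) = star (rho F);
    cone_hom_equiv : forall g F, in_cone F ->
      rho (cone_translate g F) = alpha g (rho F) }.

Definition LT_trivializable (alpha : cstar_action G A) (m : nat) : Prop :=
  exists rho : 'I_m.+1 -> cone_fun -> A,
    (forall i, equivariant_cone_hom alpha (rho i)) /\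
    \sum_(i < m.+1) rho i cone_t1 = 1.

Definition dimLT (alpha : cstar_action G A) : \bar R :=
  if pselect (exists m, `[< LT_trivializable alpha m >]) is left ex_m
  then (ex_minn ex_m)%:R%:E else +oo%E.

End LocalTrivialityDimension.

(* Main.v *)
(* If h_0, ..., h_m are self-adjoint odd elements with sum of squares 1, then
   each h_i has norm at most 1 and F |-> F(h_i), with (0,1] x Z/2 viewed as
   [-1,1] minus 0 through (t, g) |-> (-1)^g sqrt t, is an equivariant
   *-homomorphism sending t (x) 1 to h_i^2. On the quantum sphere, the real and
   imaginary parts of the z_i, the i-th ones scaled by sqrt (c_i), provide 2n
   such elements: the sum of c_i (z_i z_i^* + z_i^* z_i) / 2 is 1 as soon as
   c_j + (1 - q^2) / 2 * sum_(i < j) c_i = 1, which c_i = ((1 + q^2) / 2)^i solves.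

   The continuous functional calculus of a self-adjoint contraction h is the
   limit of the Bernstein operators f |-> E f(S_N / N), S_N being the N-th
   position of the random walk with probabilities (1 + h) / 2 and
   (1 - h) / 2; convergence and multiplicativity follow from Chebyshev's
   inequality for two independent walks. *)
Require Import Defs.
From mathcomp Require Import all_boot all_order all_algebra all_fingroup.
From mathcomp Require Import all_classical all_reals all_analysis.
From mathcomp Require Import ring lra.
Set Implicit Arguments.
Unset Strict Implicit.
Unset Printing Implicit Defensive.
Import Order.TTheory GRing.Theory Num.Theory numFieldNormedType.Exports.
Local Open Scope classical_set_scope.
Local Open Scope complex_scope.
Local Open Scope ring_scope.

(** * Norms and limits in C*-algebras *)

Section CStarNorm.
Variables (R : realType) (A : cstarAlgType R).
Implicit Types (x y : A) (r : R).

Lemma conj_real r : (r%:C : R[i])^* = r%:C.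
Proof. by apply/eqP; rewrite eq_complex /= oppr0 !eqxx. Qed.

Lemma norm_real r : `|r%:C : R[i]| = `|r|%:C.
Proof. by rewrite normc_def /= expr0n addr0 sqrtr_sqr. Qed.

Lemma starZr r x : star (r%:C *: x) = r%:C *: star x.
Proof. by rewrite starZ conj_real. Qed.

Lemma starN x : star (- x) = - star x.
Proof. by rewrite -scaleN1r starZ rmorphN1 scaleN1r. Qed.

Lemma star0 : star (0 : A) = 0.
Proof. by rewrite -(scale0r (0 : A)) starZ rmorph0 !scale0r. Qed.

Lemma starB x y : star (x - y) = star x - star y.
Proof. by rewrite starD starN. Qed.

Lemma star1 : star (1 : A) = 1.
Proof. by rewrite -[RHS]starK -{2}[star 1]mul1r starM starK mul1r. Qed.

Lemma cnormZr r x : cnorm (r%:C *: x) = `|r| * cnorm x.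
Proof. by apply: complexI; rewrite cnormZ norm_real rmorphM. Qed.

Lemma cnorm0 : cnorm (0 : A) = 0.
Proof. by rewrite -(scale0r (0 : A)) -[0 in LHS](rmorph0 (real_complex R)) cnormZr normr0 mul0r. Qed.

Lemma cnormN x : cnorm (- x) = cnorm x.
Proof.
by rewrite -scaleN1r -(rmorphN1 (real_complex R)) cnormZr normrN1 mul1r.
Qed.

Lemma cnorm_ge0 x : 0 <= cnorm x.
Proof. have := cnormD x (- x); rewrite subrr cnorm0 cnormN; lra. Qed.

Lemma cnormB x y : cnorm (x - y) <= cnorm x + cnorm y.
Proof. by rewrite -[cnorm y]cnormN cnormD. Qed.

Lemma cnorm_distC x y : cnorm (x - y) = cnorm (y - x).
Proof. by rewrite -cnormN opprB. Qed.

(** The C*-identity gives [cnorm y ^+ 2 <= cnorm (star y) * cnorm y]. Cancelling [cnorm y], for [x]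
    and for [star x], gives both inequalities. *)
Lemma cnorm_star x : cnorm (star x) = cnorm x.
Proof.
suff H y : cnorm y <= cnorm (star y) by apply: le_anti; rewrite H -{2}[x]starK H.
have [->|y0] := eqVneq (cnorm y) 0; first exact: cnorm_ge0.
have yp : 0 < cnorm y by rewrite lt_neqAle eq_sym y0 cnorm_ge0.
by rewrite -(ler_pM2r yp) -expr2 -cnorm_starM cnormM.
Qed.

Lemma cnorm_sqr x : star x = x -> cnorm (x * x) = cnorm x ^+ 2.
Proof. by move=> {1}<-; rewrite cnorm_starM. Qed.

(** The C*-identity leaves only the values 0 and 1, and 0 is excluded by [1 != 0]. *)
Lemma cnorm1 : cnorm (1 : A) = 1.
Proof.
have /eqP := cnorm_starM (1 : A); rewrite star1 mulr1 eq_sym expr2 -subr_eq0.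
rewrite -{3}[cnorm 1]mulr1 -mulrBr mulf_eq0 subr_eq0 => /orP[/eqP/cnorm_eq0 E|/eqP//].
by have := oner_neq0 A; rewrite E eqxx.
Qed.

Lemma cnorm_scalar r : cnorm (r%:C *: (1 : A)) = `|r|.
Proof. by rewrite cnormZr cnorm1 mulr1. Qed.

End CStarNorm.

Section Limits.
Variables (R : realType) (A : cstarAlgType R).
Implicit Types (x y : A) (u v : nat -> A).

Definition converges u x := (fun k => cnorm (u k - x)) @ \oo --> (0 : R).

Lemma cvg0_le (f g : nat -> R) : (forall k, 0 <= f k <= g k) ->
  g @ \oo --> (0 : R) -> f @ \oo --> (0 : R).
Proof.
move=> fg g0; apply: (squeeze_cvgr _ (cvg_cst 0) g0).
by apply: nearW => k; apply: fg.
Qed.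

Lemma converges_dist u x :
  converges u x <-> forall e : R, 0 < e -> exists N, forall k, (N <= k)%N ->
    cnorm (u k - x) < e.
Proof.
split.
  move=> /cvgrPdist_lt H e /H [N _ HN]; exists N => k /HN /=.
  by rewrite sub0r normrN ger0_norm ?cnorm_ge0.
move=> H; apply/cvgrPdist_lt => e /H [N HN]; exists N => // k /= /HN.
by rewrite sub0r normrN ger0_norm ?cnorm_ge0.
Qed.

Lemma converges_const x : converges (fun=> x) x.
Proof. by rewrite /converges subrr cnorm0; apply: cvg_cst. Qed.

Lemma converges_unique u x y : converges u x -> converges u y -> x = y.
Proof.
move=> ux uy; apply/eqP; rewrite -subr_eq0; apply/eqP/cnorm_eq0.
have S : (fun k => cnorm (u k - x) + cnorm (u k - y)) @ \oo --> (0 : R).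
  by rewrite -(addr0 0); apply: cvgD.
apply: (@cvg_unique _ _ ((fun=> cnorm (x - y)) @ \oo)) => //.
  exact: cvg_cst.
apply: cvg0_le S => k.
rewrite cnorm_ge0 /= [cnorm (u k - x)]cnorm_distC.
by apply: le_trans (cnormD _ _); rewrite addrA subrK.
Qed.

Lemma converges_add u v x y : converges u x -> converges v y ->
  converges (fun k => u k + v k) (x + y).
Proof.
move=> ux vy; have S : (fun k => cnorm (u k - x) + cnorm (v k - y)) @ \oo --> (0 : R).
  by rewrite -(addr0 0); apply: cvgD.
by apply: cvg0_le S => k; rewrite cnorm_ge0 /= opprD addrACA cnormD.
Qed.

Lemma converges_mul u v x y : converges u x -> converges v y ->
  converges (fun k => u k * v k) (x * y).
Proof.
move=> ux vy.
have S : (fun k => cnorm (u k - x) * (cnorm (v k - y) + cnorm y)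
    + cnorm x * cnorm (v k - y)) @ \oo --> 0 * (0 + cnorm y) + cnorm x * 0.
  apply: cvgD; last by apply: cvgM => //; apply: cvg_cst.
  by apply: cvgM => //; apply: cvgD => //; apply: cvg_cst.
rewrite mul0r mulr0 addr0 in S; apply: cvg0_le S => k; rewrite cnorm_ge0 /=.
have -> : u k * v k - x * y = (u k - x) * v k + x * (v k - y).
  by rewrite mulrBl mulrBr addrA subrK.
apply: le_trans (cnormD _ _) (lerD _ (cnormM _ _)).
apply: le_trans (cnormM _ _) (ler_wpM2l (cnorm_ge0 _) _).
by apply: le_trans (cnormD _ _); rewrite subrK.
Qed.

Lemma converges_scale (c : R[i]) u x : converges u x ->
  converges (fun k => c *: u k) (c *: x).
Proof.
move=> ux; have := converges_mul (converges_const (c *: 1)) ux.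
by under eq_fun do rewrite -scalerAl mul1r; rewrite -scalerAl mul1r.
Qed.

Lemma converges_star u x : converges u x -> converges (fun k => star (u k)) (star x).
Proof. by rewrite /converges; under eq_fun do rewrite -[cnorm (u _ - x)]cnorm_star starB. Qed.

End Limits.

Section ZmodCancel.
Variable V : zmodType.
Implicit Types s t x y : V.

Lemma cancel_start x y : 0 + (x - y) = 0 -> x = y.
Proof. by rewrite add0r => /subr0_eq. Qed.
Lemma cancel_bubble s t x y : s = t + x -> s + y = t + y + x.
Proof. by move->; rewrite addrAC. Qed.
Lemma cancel_opp s t x : s = t + x -> t = 0 -> s - x = 0.
Proof. by move=> -> ->; rewrite add0r subrr. Qed.
Lemma cancel_pos s t x : s = t - x -> t = 0 -> s + x = 0.
Proof. by move=> -> ->; rewrite add0r addNr. Qed.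

End ZmodCancel.

(* Decides equalities of integer combinations, with coefficients 1 and -1, of
   syntactically equal atoms in an abelian group. *)
Ltac zmod_find := first [exact: erefl | eapply cancel_bubble; zmod_find].
Ltac zmod_loop := first
  [ exact: erefl
  | eapply cancel_opp; [zmod_find | zmod_loop]
  | eapply cancel_pos; [zmod_find | zmod_loop] ].
Ltac zmod := apply: cancel_start; rewrite ?(opprD, opprK, addrA, addr0, oppr0); zmod_loop.

(** * Square roots and positive elements *)

Section SquareRoot.
Variables (R : realType) (A : cstarAlgType R).
Implicit Types (w x y z : A).

(* The fixed point y of y = (w + y^2) / 2 gives (1 - y)^2 = 1 - w. *)
Fixpoint sqrt_iter w n : A :=
  if n is m.+1 then (2^-1)%:C *: (w + sqrt_iter w m * sqrt_iter w m) else 0.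

(** The same recursion with the scalar 1 for [w]. When [cnorm w <= 1] it dominates the norms and the
    increments of [sqrt_iter]. *)
Fixpoint sqrt_bound n : R :=
  if n is m.+1 then 2^-1 * (1 + sqrt_bound m * sqrt_bound m) else 0.

Lemma sqrt_bound_itv n : 0 <= sqrt_bound n <= 1.
Proof. elim: n => [|n /andP[IH0 IH1]] /=; [lra | apply/andP; split; nra]. Qed.

Lemma sqrt_bound_incr n : sqrt_bound n <= sqrt_bound n.+1.
Proof.
elim: n => [|n IH]; first by have /andP[] := sqrt_bound_itv 1.
have /andP[??] := sqrt_bound_itv n; have /andP[??] := sqrt_bound_itv n.+1.
rewrite [leRHS]/= [leLHS]/= -/(sqrt_bound n.+1) ler_pM2l ?invr_gt0 // lerD2l.
exact: ler_pM.
Qed.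

Section Bounds.
Variable w : A.
Hypothesis w_le1 : cnorm w <= 1.

Lemma sqrt_iter_le n : cnorm (sqrt_iter w n) <= sqrt_bound n.
Proof.
elim: n => [|n IH] /=; first by rewrite cnorm0.
rewrite cnormZr ger0_norm ?invr_ge0 // ler_pM2l ?invr_gt0 //.
apply: le_trans (cnormD _ _) (lerD w_le1 _).
by apply: le_trans (cnormM _ _) (ler_pM _ _ IH IH); apply: cnorm_ge0.
Qed.

(** The identity y^2 - x^2 = y (y - x) + (y - x) x needs no commutativity and serves both
    recursions. *)
Lemma sqrt_iter_step n : cnorm (sqrt_iter w n.+1 - sqrt_iter w n)
  <= sqrt_bound n.+1 - sqrt_bound n.
Proof.
elim: n => [|n IH].
  rewrite [sqrt_iter w 0]/= [sqrt_bound 0]/= !subr0; exact: (sqrt_iter_le 1).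
set y := sqrt_iter w n.+1 in IH *; set x := sqrt_iter w n in IH *.
set s := sqrt_bound n.+1 in IH *; set t := sqrt_bound n in IH *.
have Hy : cnorm y <= s by apply: sqrt_iter_le.
have Hx : cnorm x <= t by apply: sqrt_iter_le.
have -> : sqrt_iter w n.+2 - y
    = (2^-1)%:C *: (y * (y - x) + (y - x) * x).
  rewrite [sqrt_iter w n.+2]/= -/(sqrt_iter w n.+1) -/y {2}/y /= -/x -scalerBr.
  by congr (_ *: _); rewrite mulrBr mulrBl addrA subrK opprD addrACA subrr add0r.
have -> : sqrt_bound n.+2 - s = 2^-1 * (s * (s - t) + (s - t) * t).
  have Es : s = 2^-1 * (1 + t * t) by [].
  have -> : sqrt_bound n.+2 = 2^-1 * (1 + s * s) by [].
  rewrite [X in _ - X]Es; ring.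
rewrite cnormZr ger0_norm ?invr_ge0 // ler_pM2l ?invr_gt0 //.
apply: le_trans (cnormD _ _) (lerD _ _);
  by apply: le_trans (cnormM _ _) (ler_pM _ _ _ _) => //; apply: cnorm_ge0.
Qed.

Lemma sqrt_iter_dist n m : cnorm (sqrt_iter w (m + n) - sqrt_iter w n)
  <= sqrt_bound (m + n) - sqrt_bound n.
Proof.
elim: m => [|m IH]; first by rewrite !subrr cnorm0.
rewrite addSn -(subrK (sqrt_iter w (m + n)) (sqrt_iter w _.+1)) -addrA.
apply: le_trans (cnormD _ _) _.
have := sqrt_iter_step (m + n); lra.
Qed.

Lemma sqrt_iter_cvg : exists y, converges (sqrt_iter w) y.
Proof.
(* The scalar sequence is monotone and bounded, so its increments become small, and the iterates
   they dominate are Cauchy. *)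
have incr : nondecreasing_seq sqrt_bound.
  by apply/nondecreasing_seqP; apply: sqrt_bound_incr.
have bnd : has_ubound (range sqrt_bound).
  by exists 1 => _ [n _ <-]; have /andP[] := sqrt_bound_itv n.
have cv := nondecreasing_is_cvgn incr bnd.
set l := lim (sqrt_bound @ \oo).
have le_l n : sqrt_bound n <= l by apply: nondecreasing_cvgn_le.
suff [y Hy] : exists y : A, forall e : R, 0 < e -> exists N : nat, forall k : nat,
    (N <= k)%N -> cnorm (sqrt_iter w k - y) < e.
  by exists y; apply/converges_dist.
apply: cnorm_complete => e e0.
have /cvgrPdist_lt/(_ e e0)[N _ HN] := cv.
have dist k m : (N <= m)%N -> (m <= k)%N -> cnorm (sqrt_iter w k - sqrt_iter w m) < e.
  move=> Nm mk; have := sqrt_iter_dist m (k - m); rewrite subnK // => H.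
  have := HN N (leqnn N); rewrite /= ger0_norm ?subr_ge0 ?le_l //.
  have := incr _ _ Nm; have := le_l k; rewrite -/l; lra.
exists N => k m Nk Nm; case: (leqP m k) => mk; first exact: dist.
by rewrite cnorm_distC; apply: dist => //; apply: ltnW.
Qed.

End Bounds.

Lemma sqrt_iter_star w n : star w = w -> star (sqrt_iter w n) = sqrt_iter w n.
Proof.
move=> sw; elim: n => [|n IH] /=; first exact: star0.
by rewrite starZr starD starM IH sw.
Qed.

Lemma sqrt_iter_comm w z n : w * z = z * w ->
  sqrt_iter w n * z = z * sqrt_iter w n.
Proof.
move=> wz; elim: n => [|n IH] /=; first by rewrite mul0r mulr0.
by rewrite -scalerAl -scalerAr mulrDl mulrDr wz -mulrA IH mulrA IH mulrA.
Qed.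

(** The last clause, inherited from the iterates, is what later makes square roots of commuting
    elements commute. *)
Lemma sqrt_one_sub w : star w = w -> cnorm w <= 1 ->
  exists b, [/\ star b = b, b * b = 1 - w &
    forall z, w * z = z * w -> b * z = z * b].
Proof.
move=> sw w1; have [y cy] := sqrt_iter_cvg w1.
have sy : star y = y.
  apply: converges_unique (converges_star cy) _.
  by under eq_fun do rewrite sqrt_iter_star //.
have cS : converges (fun n => sqrt_iter w n.+1) y.
  apply/converges_dist => e e0; have [N HN] := (converges_dist _ _).1 cy e e0.
  by exists N => k Nk; apply: HN; apply: leqW.
have fix_y : y = (2^-1)%:C *: (w + y * y).
  apply: converges_unique cS _ => /=.
  by apply: converges_scale; apply: converges_add (converges_const w) _;
    apply: converges_mul.
have dbl : y + y = w + y * y.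
  rewrite {1 2}fix_y -scalerDl -rmorphD.
  by rewrite (_ : 2^-1 + 2^-1 = 1 :> R) ?rmorph1 ?scale1r //; lra.
exists (1 - y); split; first by rewrite starB star1 sy.
  have -> : w = y + y - y * y by rewrite dbl addrK.
  by rewrite mulrBl mul1r mulrBr mulr1; zmod.
move=> z wz; rewrite mulrBl mulrBr mul1r mulr1; congr (_ - _).
apply: (@converges_unique _ _ (fun n => sqrt_iter w n * z)).
  exact: converges_mul cy (converges_const z).
under eq_fun do rewrite sqrt_iter_comm //.
exact: converges_mul (converges_const z) cy.
Qed.

End SquareRoot.

Section Positivity.
Variables (R : realType) (A : cstarAlgType R).
Implicit Types (w x y z b c : A) (t m : R).

Lemma commuting_squares_bound b c m : star b = b -> star c = c ->
  b * c = c * b -> b * b + c * c = m%:C *: 1 ->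
  [/\ cnorm b ^+ 2 <= `|m|, cnorm c ^+ 2 <= `|m| & cnorm (b * b - c * c) <= `|m|].
Proof.
(* [b + 'i c] is a multiple of a unitary. *)
move=> sb sc bc sum; set u := b + 'i *: c.
have su : star u = b - 'i *: c by rewrite starD starZ sb sc conjCi scaleNr.
have nu : cnorm u ^+ 2 = `|m|.
  rewrite -cnorm_starM -(cnorm_scalar A) -sum; congr cnorm.
  rewrite su mulrBl !mulrDr -!scalerAl -!scalerAr scalerA mulCii scaleN1r bc; zmod.
have nus : cnorm (star u) = cnorm u by rewrite cnorm_star.
have u0 := cnorm_ge0 u.
have two x : x + x = (2 : R)%:C *: x by rewrite -[2]/(1 + 1) rmorphD scalerDl scale1r.
have half x : cnorm (x + x) = 2 * cnorm x by rewrite two cnormZr ger0_norm.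
have nb : cnorm b <= cnorm u.
  have := cnormD u (star u).
  have -> : u + star u = b + b by rewrite su /u; zmod.
  rewrite half nus; lra.
have nc : cnorm c <= cnorm u.
  have : cnorm ('i *: c) = cnorm c.
    by apply: complexI; rewrite cnormZ normCi mul1r.
  have := cnormB u (star u).
  have -> : u - star u = 'i *: c + 'i *: c by rewrite su /u; zmod.
  rewrite half nus; lra.
split; rewrite -?nu ?lerXn2r // ?nnegrE ?cnorm_ge0 //.
(* This sum equals 2 (b^2 - c^2), which gives the third bound. *)
have : cnorm (u * u + star u * star u) <= 2 * cnorm u ^+ 2.
  apply: le_trans (cnormD _ _) _; rewrite mulr_natl mulr2n expr2.
  by apply: lerD; apply: le_trans (cnormM _ _) _; rewrite ?nus.
have -> : u * u + star u * star u = (b * b - c * c) + (b * b - c * c).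
  rewrite su /u !mulrBl !mulrDl !mulrDr !mulrN -!scalerAl -!scalerAr.
  rewrite !scalerA mulCii scaleN1r.
  zmod.
rewrite half; lra.
Qed.

Lemma scalar_comm r x : (r%:C *: 1) * x = x * (r%:C *: 1).
Proof. by rewrite -scalerAl -scalerAr mul1r mulr1. Qed.

Lemma star_scalar r : star (r%:C *: (1 : A)) = r%:C *: 1.
Proof. by rewrite starZr star1. Qed.

(* Equivalent, for self-adjoint x, to having spectrum in [0, +oo). *)
Definition cpositive x :=
  star x = x /\ exists2 t : R, 0 <= t & cnorm (t%:C *: 1 - x) <= t.

Lemma cpositive_add x y : cpositive x -> cpositive y -> cpositive (x + y).
Proof.
move=> [sx [t t0 xt]] [sy [s s0 ys]]; split; first by rewrite starD sx sy.
exists (t + s); first exact: addr_ge0.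
rewrite rmorphD scalerDl opprD addrACA.
exact: le_trans (cnormD _ _) (lerD _ _).
Qed.

Lemma cpositive_scale r x : 0 <= r -> cpositive x -> cpositive (r%:C *: x).
Proof.
move=> r0 [sx [t t0 xt]]; split; first by rewrite starZr sx.
exists (r * t); first exact: mulr_ge0.
by rewrite rmorphM -scalerA -scalerBr cnormZr ger0_norm // ler_wpM2l.
Qed.

Lemma cpositive_norm_sub x m : star x = x -> cnorm x <= m ->
  cpositive (m%:C *: 1 - x).
Proof.
move=> sx xm; split; first by rewrite starB star_scalar sx.
exists m; first exact: le_trans (cnorm_ge0 _) xm.
by rewrite opprB addrC subrK.
Qed.

Lemma cpositive_scalar r : 0 <= r -> cpositive (r%:C *: 1).
Proof.
move=> r0; rewrite -[_ *: 1]subr0.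
by apply: cpositive_norm_sub; rewrite ?star0 ?cnorm0.
Qed.

Lemma cpositive0 : cpositive 0.
Proof. by rewrite -(scale0r (1 : A)); apply: cpositive_scalar. Qed.

Lemma cpositive_sum (I : Type) (s : seq I) (P : pred I) (F : I -> A) :
  (forall i, P i -> cpositive (F i)) -> cpositive (\sum_(i <- s | P i) F i).
Proof.
move=> FP; apply: (big_ind cpositive) => //; first exact: cpositive0.
exact: cpositive_add.
Qed.

Lemma cpositive_sqrt x : cpositive x -> exists b,
  [/\ star b = b, b * b = x & forall z, x * z = z * x -> b * z = z * b].
Proof.
(* As [t] may be 0, it is enlarged to s = t + 1, which keeps the norm condition and allows division:
   x / s = 1 - w with [cnorm w <= 1]. *)
move=> [sx [t t0 xt]]; have s0 : 0 < t + 1 by lra.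
have xs : cnorm ((t + 1)%:C *: 1 - x) <= t + 1.
  rewrite rmorphD scalerDl addrAC; apply: le_trans (cnormD _ _) (lerD xt _).
  by rewrite cnorm_scalar normr1.
move: (t + 1) s0 xs => s s0 xs {t t0 xt}.
have sw : star (1 - s^-1%:C *: x) = 1 - s^-1%:C *: x.
  by rewrite starB star1 starZr sx.
have sV : s%:C * s^-1%:C = 1 :> R[i] by rewrite -rmorphM divff ?gt_eqF ?rmorph1.
have w1 : cnorm (1 - s^-1%:C *: x) <= 1.
  rewrite -(ler_pM2l s0) -{1}(gtr0_norm s0) -cnormZr scalerBr scalerA mulr1.
  by rewrite sV scale1r.
have [b [sb bb bc]] := sqrt_one_sub sw w1.
exists ((Num.sqrt s)%:C *: b); split; first by rewrite starZr sb.
  rewrite -scalerAl -scalerAr scalerA -rmorphM -expr2 sqr_sqrtr ?ltW // bb.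
  by rewrite opprB addrC subrK scalerA sV scale1r.
move=> z xz; rewrite -scalerAl -scalerAr bc //.
by rewrite mulrBl mulrBr mul1r mulr1 -scalerAl -scalerAr xz.
Qed.

(** With m = [cnorm x ^+ 2], the element m - x^2 has a square root b commuting with x. As b^2 + x^2
    = m, [commuting_squares_bound] bounds the norm of b^2 = m - x^2 by m. *)
Lemma cpositive_sqr x : star x = x -> cpositive (x * x).
Proof.
move=> sx; split; first by rewrite starM sx.
have t0 : 0 <= cnorm x ^+ 2 by rewrite exprn_ge0 ?cnorm_ge0.
exists (cnorm x ^+ 2) => //.
have /cpositive_sqrt[b [sb bb bc]] : cpositive ((cnorm x ^+ 2)%:C *: 1 - x * x).
  by apply: cpositive_norm_sub; rewrite ?starM ?sx // cnorm_sqr.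
rewrite -bb cnorm_sqr // -(ger0_norm t0).
have [] // := @commuting_squares_bound b x (cnorm x ^+ 2) => //.
  by apply: bc; rewrite mulrBl mulrBr scalar_comm mulrA.
by rewrite bb subrK.
Qed.

Lemma cpositive_mul x y : cpositive x -> cpositive y -> x * y = y * x ->
  cpositive (x * y).
Proof.
move=> px py xy; have [c [sc cc cC]] := cpositive_sqrt px.
have [d [sd dd dC]] := cpositive_sqrt py.
have dc : d * c = c * d by apply: dC; rewrite cC.
have -> : x * y = (c * d) * (c * d).
  by rewrite -cc -dd -!mulrA [d * (c * d)]mulrA dc -!mulrA.
by apply: cpositive_sqr; rewrite starM sc sd.
Qed.

(** The square roots b of m - x and c of m + x commute and b^2 + c^2 = 2 m, so
    [commuting_squares_bound] bounds b^2 - c^2 = - 2 x by 2 m. *)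
Lemma cnorm_le_positive x m : star x = x -> 0 <= m ->
  cpositive (m%:C *: 1 - x) -> cpositive (m%:C *: 1 + x) -> cnorm x <= m.
Proof.
move=> sx m0 /cpositive_sqrt[b [sb bb bC]] /cpositive_sqrt[c [sc cc cC]].
have bc : b * c = c * b.
  apply: bC; apply/esym; apply: cC.
  by rewrite mulrDl mulrBl !(mulrBr, mulrDr) (scalar_comm m x); zmod.
have two y : y + y = (2 : R)%:C *: y by rewrite -[2]/(1 + 1) rmorphD scalerDl scale1r.
have [] := @commuting_squares_bound b c (2 * m) => //.
  by rewrite bb cc rmorphM -scalerA -two; zmod.
move=> _ _; rewrite bb cc.
have -> : m%:C *: 1 - x - (m%:C *: 1 + x) = - (x + x) by zmod.
rewrite cnormN two cnormZr ger0_norm // ger0_norm ?mulr_ge0 //; lra.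
Qed.

Lemma cnorm_mono x y : cpositive x -> cpositive (y - x) -> cnorm x <= cnorm y.
Proof.
move=> px pyx; have sx := px.1.
have sy : star y = y by rewrite -(subrK x y) starD pyx.1 sx.
apply: cnorm_le_positive => //; first exact: cnorm_ge0.
  have -> : (cnorm y)%:C *: 1 - x = ((cnorm y)%:C *: 1 - y) + (y - x) by zmod.
  by apply: cpositive_add => //; apply: cpositive_norm_sub.
by apply: cpositive_add => //; apply/cpositive_scalar/cnorm_ge0.
Qed.

End Positivity.

Lemma star_hom_cpositive (R : realType) (A B : cstarAlgType R)
    (phi : {lrmorphism A -> B}) (x : A) :
  star_preserving phi -> cpositive x -> cpositive (phi x).
Proof.
move=> sphi /cpositive_sqrt[b [sb <- _]]; rewrite rmorphM.
by apply: cpositive_sqr; rewrite -sphi sb.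
Qed.

(** The C*-identity reduces this to the self-adjoint y = [star x * x], where [phi] preserves
    positivity of [cnorm y] minus or plus y. Contractivity later lets [phi] pass through limits. *)
Lemma star_hom_contractive (R : realType) (A B : cstarAlgType R)
    (phi : {lrmorphism A -> B}) (x : A) :
  star_preserving phi -> cnorm (phi x) <= cnorm x.
Proof.
move=> sphi; rewrite -(ler_pXn2r (n := 2)) ?nnegrE ?cnorm_ge0 //.
rewrite -!cnorm_starM -sphi -rmorphM.
have : star (star x * x) = star x * x by rewrite starM starK.
move: (star x * x) => y sy.
have phiS r : phi (r%:C *: 1) = r%:C *: 1 by rewrite linearZ rmorph1.
apply: cnorm_le_positive; rewrite ?cnorm_ge0 // -?sphi ?sy //.
  by rewrite -phiS -rmorphB; apply/star_hom_cpositive/cpositive_norm_sub.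
rewrite -phiS -rmorphD; apply: star_hom_cpositive => //.
by rewrite -{2}[y]opprK; apply: cpositive_norm_sub; rewrite ?cnormN // starN sy.
Qed.

(** For real f between -g and g, positivity puts L f between - L g and L g. The factor 2 comes from
    treating real and imaginary parts separately. *)
Lemma positive_map_bound (R : realType) (A : cstarAlgType R) (T : Type)
    (L : (T -> R[i]) -> A) (f : T -> R[i]) (g : T -> R) :
  (forall f1 f2, L (fun t => f1 t + f2 t) = L f1 + L f2) ->
  (forall c f1, L (fun t => c * f1 t) = c *: L f1) ->
  (forall f1 : T -> R, (forall t, 0 <= f1 t) -> cpositive (L (fun t => (f1 t)%:C))) ->
  (forall t, `|f t| <= (g t)%:C) ->
  cnorm (L f) <= 2 * cnorm (L (fun t => (g t)%:C)).
Proof.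
move=> LD LZ L0 fg.
have LB (u v : T -> R) : L (fun t => (u t - v t)%:C)
    = L (fun t => (u t)%:C) - L (fun t => (v t)%:C).
  rewrite -scaleN1r -LZ -LD; congr L; apply/funext => t.
  by rewrite rmorphB mulN1r.
have real_bound (u : T -> R) : (forall t, `|u t| <= g t) ->
    cnorm (L (fun t => (u t)%:C)) <= cnorm (L (fun t => (g t)%:C)).
  move=> ug.
  have pm : cpositive (L (fun t => (g t - u t)%:C)).
    by apply: L0 => t; have := ug t; rewrite ler_norml; lra.
  have pp : cpositive (L (fun t => (g t - - u t)%:C)).
    by apply: L0 => t; have := ug t; rewrite ler_norml; lra.
  have pg : cpositive (L (fun t => (g t)%:C)).
    by apply: L0 => t; apply: le_trans (ug t).
  have LN : L (fun t => (- u t)%:C) = - L (fun t => (u t)%:C).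
    rewrite -scaleN1r -LZ; congr L; apply/funext => t.
    by rewrite rmorphN mulN1r.
  have sg := pg.1.
  rewrite !LB LN opprK in pm pp.
  have su : star (L (fun t => (u t)%:C)) = L (fun t => (u t)%:C).
    by rewrite -[L _ in LHS](addKr (L (fun t => (g t)%:C))) starD starN sg pp.1 addKr.
  have gg := cpositive_norm_sub sg (lexx _).
  apply: cnorm_le_positive => //; first exact: cnorm_ge0.
    by have := cpositive_add gg pm; rewrite addrA subrK.
  by have := cpositive_add gg pp; rewrite addrA subrK.
have -> : L f = L (fun t => (complex.Re (f t))%:C)
    + 'i *: L (fun t => (complex.Im (f t))%:C).
  rewrite -LZ -LD; congr L; apply/funext => t; rewrite -complexiE.
  by case: (f t) => x y; rewrite [LHS]complexE.
have ni x : cnorm ('i *: x : A) = cnorm x.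
  by apply: complexI; rewrite cnormZ normCi mul1r.
apply: le_trans (cnormD _ _) _; rewrite ni mulr_natl mulr2n.
apply: lerD; apply: real_bound => t; rewrite -lecR -norm_real;
  apply: le_trans (fg t); rewrite norm_real.
  exact: normc_ge_Re.
by rewrite normc_def lecR -sqrtr_sqr ler_sqrt ?lerDr ?addr_ge0 ?sqr_ge0.
Qed.

(** * Continuous functional calculus *)

Section Walk.
Variables (R : realType) (A : cstarAlgType R).
Implicit Types (a b x y : A) (g : R -> A) (f : R -> R[i]).

(* With a and b replaced by the probabilities of the steps 1 and -1, this is
   the expectation of g at time N of a random walk on the integers. *)
Fixpoint walk a b N g : A :=
  if N is M.+1 then a * walk a b M (fun p => g (p + 1))
                    + b * walk a b M (fun p => g (p - 1)) else g 0.

(** Only positions with |p| <= N are reached, so [fcalc_square] may use a function known only on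
    [-1, 1]. *)
Lemma eq_walk a b N g1 g2 : (forall p, `|p| <= N%:R -> g1 p = g2 p) ->
  walk a b N g1 = walk a b N g2.
Proof.
elim: N g1 g2 => [|N IH] g1 g2 eq_g /=; first by apply: eq_g; rewrite normr0.
by congr (_ * _ + _ * _); apply: IH => p pN; apply: eq_g;
  move: pN; rewrite -natr1 !ler_norml => ?; lra.
Qed.

Lemma walk_add a b N g1 g2 :
  walk a b N (fun p => g1 p + g2 p) = walk a b N g1 + walk a b N g2.
Proof.
by elim: N g1 g2 => [//|N IH] g1 g2 /=; rewrite !IH !mulrDr; zmod.
Qed.

Lemma walk_scale a b N (c : R[i]) g :
  walk a b N (fun p => c *: g p) = c *: walk a b N g.
Proof.
by elim: N g => [//|N IH] g /=; rewrite !IH scalerDr -!scalerAr.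
Qed.

Lemma walk_mulr a b N g x : walk a b N (fun p => g p * x) = walk a b N g * x.
Proof. by elim: N g => [//|N IH] g /=; rewrite !IH mulrDl !mulrA. Qed.

Lemma walk_const a b N x : a + b = 1 -> walk a b N (fun=> x) = x.
Proof. by move=> ab; elim: N => [//|N /= ->]; rewrite -mulrDl ab mul1r. Qed.

Lemma walk_swap a b N g : walk b a N g = walk a b N (fun p => g (- p)).
Proof.
elim: N g => [|N IH] g /=; first by rewrite oppr0.
rewrite !IH addrC; congr (_ * _ + _ * _); apply: eq_walk => p _;
  by rewrite opprD ?opprK.
Qed.

Lemma walk_comm a b N g x : a * x = x * a -> b * x = x * b ->
  (forall p, g p * x = x * g p) -> walk a b N g * x = x * walk a b N g.
Proof.
move=> ax bx; elim: N g => [|N IH] g gx /=; first exact: gx.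
by rewrite mulrDl mulrDr -!mulrA !IH // !mulrA ax bx.
Qed.

(** Commutation is needed to apply [cpositive_mul] to each weight and the walk that it
    multiplies. *)
Lemma walk_positive a b N g : cpositive a -> cpositive b -> a * b = b * a ->
  (forall p, [/\ cpositive (g p), a * g p = g p * a & b * g p = g p * b]) ->
  cpositive (walk a b N g).
Proof.
move=> pa pb ab; elim: N g => [|N IH] g pg /=; first by have [] := pg 0.
by apply: cpositive_add; apply: cpositive_mul => //; try exact: IH;
  apply/esym; apply: walk_comm => // p; have [_ ea eb] := pg (p + 1);
  have [_ ea' eb'] := pg (p - 1).
Qed.

End Walk.

Lemma walk_hom (R : realType) (A B : cstarAlgType R) (phi : {lrmorphism A -> B})
    (a b : A) N (g : R -> A) :
  phi (walk a b N g) = walk (phi a) (phi b) N (phi \o g).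
Proof.
elim: N g => [//|N IH] g /=.
by rewrite rmorphD; congr (_ + _); rewrite rmorphM; congr (_ * _); apply: IH.
Qed.

(** * Moments of the random walk with steps weighted by (1 + h) / 2 and (1 - h) / 2 *)

Section ScalarWalk.
Variables (R : realType) (A : cstarAlgType R) (h : A).
Hypotheses (star_h : star h = h) (h_le1 : cnorm h <= 1).

Local Notation a := ((2^-1)%:C *: (1 + h)).
Local Notation b := ((2^-1)%:C *: (1 - h)).

Definition walk_scalar N (f : R -> R[i]) : A := walk a b N (fun p => f p *: 1).

Lemma step_sum : a + b = 1.
Proof.
rewrite -scalerDr (_ : 1 + h + (1 - h) = 1 + 1); last by zmod.
rewrite scalerDr -scalerDl -rmorphD (_ : 2^-1 + 2^-1 = 1 :> R) ?rmorph1 ?scale1r //.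
lra.
Qed.

Lemma step_diff : a - b = h.
Proof.
rewrite -scalerBr (_ : 1 + h - (1 - h) = h + h); last by zmod.
rewrite scalerDr -scalerDl -rmorphD (_ : 2^-1 + 2^-1 = 1 :> R) ?rmorph1 ?scale1r //.
lra.
Qed.

Lemma step_comm x : h * x = x * h -> a * x = x * a /\ b * x = x * b.
Proof.
move=> hx; rewrite -!scalerAl -!scalerAr.
by rewrite !(mulrDl, mulrDr) !(mul1r, mulr1) mulNr mulrN hx.
Qed.

Lemma step_positive : cpositive a /\ cpositive b.
Proof.
have half0 : 0 <= 2^-1 :> R by rewrite invr_ge0.
split; apply: cpositive_scale => //; last first.
  by have := cpositive_norm_sub star_h h_le1; rewrite rmorph1 scale1r.
have := @cpositive_norm_sub _ _ (- h) 1; rewrite rmorph1 scale1r opprK.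
by apply; rewrite ?starN ?star_h // cnormN.
Qed.

Lemma step_mul_comm : a * b = b * a.
Proof.
have [_ hb] := @step_comm h erefl.
by have [] := @step_comm b (esym hb).
Qed.

Lemma eq_walk_scalar N f1 f2 : (forall p, `|p| <= N%:R -> f1 p = f2 p) ->
  walk_scalar N f1 = walk_scalar N f2.
Proof. by move=> E; apply: eq_walk => p /E ->. Qed.

Lemma walk_scalarD N f1 f2 :
  walk_scalar N (fun p => f1 p + f2 p) = walk_scalar N f1 + walk_scalar N f2.
Proof.
rewrite /walk_scalar -walk_add; apply: eq_walk => p _; exact: scalerDl.
Qed.

Lemma walk_scalarZ N c f :
  walk_scalar N (fun p => c * f p) = c *: walk_scalar N f.
Proof.
by rewrite /walk_scalar -walk_scale; apply: eq_walk => p _; rewrite scalerA.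
Qed.

Lemma walk_scalar_const N c : walk_scalar N (fun=> c) = c *: 1.
Proof. exact: walk_const step_sum. Qed.

Lemma walk_scalar_comm N f x : h * x = x * h ->
  walk_scalar N f * x = x * walk_scalar N f.
Proof.
move=> /step_comm[ax bx]; apply: walk_comm => // p.
by rewrite -scalerAl -scalerAr mul1r mulr1.
Qed.

Lemma walk_scalar_star N f :
  star (walk_scalar N f) = walk_scalar N (fun p => (f p)^*).
Proof.
have [[sa _] [sb _]] := step_positive; rewrite /walk_scalar.
elim: N f => [|N IH] f; first by rewrite /= starZ star1.
have [ac bc] : (forall f, a * walk_scalar N f = walk_scalar N f * a)
    /\ (forall f, b * walk_scalar N f = walk_scalar N f * b).
  by split=> g; apply/esym; apply: walk_scalar_comm; have [E1 E2] := @step_comm h erefl; rewrite -?E1 -?E2.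
rewrite [walk _ _ N.+1 _]/= starD !starM sa sb.
rewrite (IH (fun p => f (p + 1))) (IH (fun p => f (p - 1))).
by rewrite -(ac (fun p => (f (p + 1))^*)) -(bc (fun p => (f (p - 1))^*)).
Qed.

Lemma walk_scalarS N f : walk_scalar N.+1 f =
  a * walk_scalar N (fun p => f (p + 1)) + b * walk_scalar N (fun p => f (p - 1)).
Proof. by []. Qed.

(** Each step has mean a - b = h. *)
Lemma walk_mean N : walk_scalar N (fun p => p%:C) = N%:R%:C *: h.
Proof.
elim: N => [|N IH]; first by rewrite /walk_scalar /= rmorph0 !scale0r.
rewrite walk_scalarS.
rewrite (eq_walk_scalar (f2 := fun p => p%:C + 1)); last by move=> p _; rewrite rmorphD.
rewrite (eq_walk_scalar (f1 := fun p => (p - 1)%:C) (f2 := fun p => p%:C + - 1)); last first.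
  by move=> p _; rewrite rmorphB.
rewrite !walk_scalarD IH !walk_scalar_const scaleN1r scale1r mulrBr mulrDr !mulr1.
rewrite addrACA -mulrDl step_sum mul1r step_diff.
by rewrite -natr1 rmorphD scalerDl scale1r.
Qed.

(** [x] and [z] get the weight a + b = 1, and [y] the weight a - b = h. This is the recursion of the
    second moment, from the expansions of (p + 1)^2 and (p - 1)^2. *)
Lemma step_combine x y z :
  a * (x + (y + z)) + b * (x + (- y + z)) = x + z + h * y.
Proof.
have <- : (a + b) * (x + z) + (a - b) * y = x + z + h * y.
  by rewrite step_sum step_diff mul1r.
by rewrite mulrBl !mulrDl !mulrDr !mulrN; zmod.
Qed.

(** In the square of a sum of N independent signs, the N squares have mean 1 and the N (N - 1) mixed
    products have mean h^2. *)
Lemma walk_square_mean N : walk_scalar N (fun p => (p ^+ 2)%:C)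
  = N%:R%:C *: 1 + (N%:R * (N%:R - 1))%:C *: (h * h).
Proof.
elim: N => [|N IH]; first by rewrite /walk_scalar /= mul0r expr0n !rmorph0 !scale0r addr0.
rewrite walk_scalarS.
rewrite (eq_walk_scalar (f2 := fun p => (p ^+ 2)%:C + (2%:C * p%:C + 1))); last first.
  by move=> p _; rewrite -rmorphM -(rmorph1 (real_complex R)) -!rmorphD; congr _%:C; ring.
rewrite (eq_walk_scalar (f1 := fun p => ((p - 1) ^+ 2)%:C)
  (f2 := fun p => (p ^+ 2)%:C + ((- 2)%:C * p%:C + 1))); last first.
  by move=> p _; rewrite -rmorphM -(rmorph1 (real_complex R)) -!rmorphD; congr _%:C; ring.
rewrite !walk_scalarD !walk_scalarZ IH walk_mean walk_scalar_const scale1r.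
rewrite rmorphN scaleNr step_combine -!scalerAr scalerA.
have -> : (N.+1%:R * (N.+1%:R - 1))%:C
    = (N%:R * (N%:R - 1))%:C + 2%:C * N%:R%:C :> R[i].
  by rewrite -rmorphM -rmorphD; congr _%:C; rewrite -natr1; ring.
have -> : N.+1%:R%:C = N%:R%:C + 1 :> R[i].
  by rewrite -natr1 rmorphD rmorph1.
by rewrite !scalerDl scale1r; zmod.
Qed.
End ScalarWalk.

(** The quadratic modulus of continuity lets the variance of the walk control the error, as in
    Chebyshev's inequality. Bounded uniformly continuous functions have it, with C of order sup |f|
    / d^2 for the d attached to e. *)
Definition tame (R : realType) (f : R -> R[i]) : Prop :=
  (exists B : R, forall s, `|f s| <= B%:C) /\
  forall e : R, 0 < e -> exists2 C : R, 0 <= C &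
    forall s t, `|f s - f t| <= (e + C * (s - t) ^+ 2)%:C.

(** * Bernstein operators and their limit *)

Section Calculus.
Variables (R : realType) (A : cstarAlgType R) (h : A).
Hypotheses (star_h : star h = h) (h_le1 : cnorm h <= 1).
Implicit Types (f g : R -> R[i]).

Local Notation a := ((2^-1)%:C *: (1 + h)).
Local Notation b := ((2^-1)%:C *: (1 - h)).

(** The expectation over two independent walks, nested because [walk] accepts values in [A].
    Different lengths allow two Bernstein operators to be compared. *)
Definition walk_pair N M (F : R * R -> R[i]) : A :=
  walk a b N (fun p => walk_scalar h M (fun r => F (p, r))).

Lemma walk_pairD N M F G : walk_pair N M (fun t => F t + G t)
  = walk_pair N M F + walk_pair N M G.
Proof.
by rewrite /walk_pair -walk_add; apply: eq_walk => p _; rewrite walk_scalarD.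
Qed.

Lemma walk_pairZ N M c F : walk_pair N M (fun t => c * F t) = c *: walk_pair N M F.
Proof.
by rewrite /walk_pair -walk_scale; apply: eq_walk => p _; rewrite walk_scalarZ.
Qed.

Lemma walk_pair_mul N M f g : walk_pair N M (fun t => f t.1 * g t.2)
  = walk_scalar h N f * walk_scalar h M g.
Proof.
rewrite /walk_pair [walk_scalar h N f]/walk_scalar -walk_mulr.
apply: eq_walk => p _; rewrite -scalerAl mul1r.
exact: (walk_scalarZ _ _ (f p) g).
Qed.

Lemma walk_pair_fst N M f : walk_pair N M (fun t => f t.1) = walk_scalar h N f.
Proof. by apply: eq_walk => p _; apply: (walk_scalar_const _ M (f p)). Qed.

Lemma walk_pair_snd N M f : walk_pair N M (fun t => f t.2) = walk_scalar h M f.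
Proof. exact: (walk_const N (walk_scalar h M f) (step_sum h)). Qed.

Lemma walk_pair_positive N M (F : R * R -> R) : (forall t, 0 <= F t) ->
  cpositive (walk_pair N M (fun t => (F t)%:C)).
Proof.
move=> F0; have [pa pb] := step_positive star_h h_le1.
apply: walk_positive => //; first exact: step_mul_comm.
move=> p; have [ca cb] : (forall f, a * walk_scalar h M f = walk_scalar h M f * a)
    /\ (forall f, b * walk_scalar h M f = walk_scalar h M f * b).
  by split=> f; apply/esym; apply: walk_scalar_comm;
    have [E1 E2] := @step_comm _ _ h h erefl; rewrite -?E1 -?E2.
split=> //; apply: walk_positive => //; first exact: step_mul_comm.
move=> r; split; first exact: cpositive_scalar.
  by rewrite -[RHS]scalerAl -[LHS]scalerAr mul1r mulr1.
by rewrite -[RHS]scalerAl -[LHS]scalerAr mul1r mulr1.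
Qed.

(* The variance of the difference of two independent averaged walks. *)
Lemma walk_pair_variance N M :
  walk_pair N.+1 M.+1 (fun t => ((t.1 / N.+1%:R - t.2 / M.+1%:R) ^+ 2)%:C)
  = (N.+1%:R^-1 + M.+1%:R^-1)%:C *: (1 - h * h).
Proof.
have [n0 m0] : N.+1%:R != 0 :> R /\ M.+1%:R != 0 :> R by rewrite !pnatr_eq0.
have En := walk_square_mean h N.+1; have Em := walk_square_mean h M.+1.
have Fn := walk_mean h N.+1; have Fm := walk_mean h M.+1.
move: N.+1%:R M.+1%:R n0 m0 En Em Fn Fm => n m n0 m0 En Em Fn Fm.
pose sq (p : R) := (p ^+ 2)%:C.
have -> : (fun t : R * R => ((t.1 / n - t.2 / m) ^+ 2)%:C) =
    (fun t => (n ^- 2)%:C * sq t.1 + ((m ^- 2)%:C * sq t.2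
      + (- 2 / (n * m))%:C * (t.1%:C * t.2%:C))).
  apply/funext => t; rewrite /sq -!rmorphM -!rmorphD.
  by congr _%:C; field; rewrite n0 m0.
rewrite !walk_pairD !walk_pairZ.
rewrite (walk_pair_fst _ _ sq) (walk_pair_snd _ _ sq).
rewrite (walk_pair_mul _ _ (fun p => p%:C) (fun p => p%:C)) En Em Fn Fm.
rewrite -scalerAl -scalerAr !scalerDr !scalerA -!rmorphM.
(* The coefficient of h^2 is (1 - 1/n) + (1 - 1/m) - 2, the -2 coming from the product of the
   means. *)
have eqs c1 c2 c3 c4 c5 d e (x y : A) : c1 + c3 = d :> R -> c2 + c4 + c5 = - e ->
    c1%:C *: x + c2%:C *: y + (c3%:C *: x + c4%:C *: y + c5%:C *: y)
    = d%:C *: x - e%:C *: y.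
  move=> <- E; rewrite -scaleNr -rmorphN -E !rmorphD !scalerDl; zmod.
rewrite scalerN.
by apply: eqs; field; rewrite n0 ?m0.
Qed.

(** Taking [N.+1] steps avoids division by 0. *)
Definition bernstein N f : A := walk_scalar h N.+1 (fun p => f (p / N.+1%:R)).

(** With X and Y the two averaged walks, the difference is the expectation of F = f(X) (g(Y) -
    g(X)), dominated by G = B (e + C (X - Y)^2), whose expectation comes from the variance. The case
    f = 1 gives the Cauchy property, the case N = M multiplicativity. *)
Lemma bernstein_mul_error N M f g (B e C : R) :
  0 <= e -> 0 <= C -> (forall s, `|f s| <= B%:C) ->
  (forall s t, `|g s - g t| <= (e + C * (s - t) ^+ 2)%:C) ->
  cnorm (bernstein N f * bernstein M g - bernstein N (fun s => f s * g s))
    <= 2 * B * (e + 2 * C * (N.+1%:R^-1 + M.+1%:R^-1)).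
Proof.
move=> e0 C0 fB gC.
have B0 : 0 <= B by rewrite -lecR; apply: le_trans (normr_ge0 _) (fB 0).
pose n : R := N.+1%:R; pose m : R := M.+1%:R.
pose F (t : R * R) := f (t.1 / n) * (g (t.2 / m) - g (t.1 / n)).
pose G (t : R * R) := B * e + B * C * (t.1 / n - t.2 / m) ^+ 2.
have -> : bernstein N f * bernstein M g - bernstein N (fun s => f s * g s)
    = walk_pair N.+1 M.+1 F.
  rewrite /bernstein -walk_pair_mul -(walk_pair_fst N.+1 M.+1) -scaleN1r -walk_pairZ.
  rewrite -walk_pairD; congr walk_pair; apply/funext => t.
  by rewrite /F mulrBr mulN1r.
have := positive_map_bound (walk_pairD N.+1 M.+1) (walk_pairZ N.+1 M.+1)
  (@walk_pair_positive N.+1 M.+1) (f := F) (g := G).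
move=> /(_ _)/le_trans; apply.
  move=> t; rewrite /F /G -mulrA -mulrDr rmorphM normrM.
  apply: ler_pM; rewrite ?normr_ge0 ?fB //; rewrite distrC; exact: gC.
rewrite -mulrA ler_pM2l //.
have -> : (fun t => (G t)%:C) = (fun t => (B * e)%:C +
    (B * C)%:C * ((t.1 / n - t.2 / m) ^+ 2)%:C).
  by apply/funext => t; rewrite /G rmorphD; congr (_ + _); apply: rmorphM.
rewrite walk_pairD walk_pairZ walk_pair_variance -/n -/m.
rewrite (walk_pair_fst _ _ (fun=> (B * e)%:C)) walk_scalar_const.
apply: le_trans (cnormD _ _) _; rewrite !cnormZr cnorm1 mulr1.
have nm0 : 0 <= n^-1 + m^-1 by rewrite addr_ge0 ?invr_ge0.
have h1 : cnorm (1 - h * h) <= 2.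
  have := cnormB 1 (h * h); rewrite cnorm1 cnorm_sqr //.
  have : cnorm h ^+ 2 <= 1 by rewrite expr_le1 ?cnorm_ge0.
  lra.
rewrite !ger0_norm ?mulr_ge0 //.
have : 0 <= B * C * (n^-1 + m^-1) * (2 - cnorm (1 - h * h)).
  by rewrite !mulr_ge0 // subr_ge0.
move: (n^-1 + m^-1) (cnorm (1 - h * h)) => x y; lra.
Qed.

Lemma bernstein_const N c : bernstein N (fun=> c) = c *: 1.
Proof. exact: walk_scalar_const. Qed.

Lemma inv_succ_small (e : R) : 0 < e ->
  exists N, forall k, (N <= k)%N -> k.+1%:R^-1 < e.
Proof. by move=> e0; have [N _ HN] := near_infty_natSinv_lt (PosNum e0); exists N. Qed.

Lemma bernstein_cvg f : tame f -> exists x, converges (bernstein^~ f) x.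
Proof.
move=> [_ fC].
suff [y Hy] : exists y : A, forall e : R, 0 < e -> exists N : nat, forall k : nat,
    (N <= k)%N -> cnorm (bernstein k f - y) < e by exists y; apply/converges_dist.
apply: cnorm_complete => e e0.
(* With f = 1 the error is at most 2 (e / 8) + 8 C d, and [dC] gives 4 C d <= e / 8, so the total is
   at most e / 2. Using [C + 1] covers C = 0. *)
have e8 : 0 < e / 8 by rewrite divr_gt0.
have [C C0 HC] := fC _ e8; have C1 : 0 < C + 1 by rewrite ltr_wpDl.
have d0 : 0 < e / 8 / (4 * (C + 1)) by rewrite divr_gt0 ?mulr_gt0.
have dC : 4 * (C * (e / 8 / (4 * (C + 1)))) = e / 8 - 4 * (e / 8 / (4 * (C + 1))).
  by field; rewrite gt_eqF.
move: (_ / (4 * _)) d0 dC => d d0 dC.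
have [N HN] := inv_succ_small d0; exists N => k l /HN Nk /HN Nl.
have one_le1 : `|1 : R[i]| <= 1%:C by rewrite normr1.
have := @bernstein_mul_error l k (fun=> 1) f 1 (e / 8) C (ltW e8) C0 (fun=> one_le1) HC.
rewrite bernstein_const scale1r mul1r.
have -> : (fun s => 1 * f s) = f by apply/funext => s; rewrite mul1r.
move=> /le_lt_trans; apply.
move: (k.+1%:R^-1) (l.+1%:R^-1) (ltW Nk) (ltW Nl) => x y xd yd.
have := ler_wpM2l C0 xd; have := ler_wpM2l C0 yd; lra.
Qed.

(** The default 0 is returned when there is no limit. *)
Definition fcalc f : A := xget 0 [set x | converges (bernstein^~ f) x].

Lemma fcalc_eq f x : converges (bernstein^~ f) x -> fcalc f = x.
Proof.
by move=> fx; apply: converges_unique (fx); apply: (xgetI 0 fx).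
Qed.

Lemma fcalc_cvg f : tame f -> converges (bernstein^~ f) (fcalc f).
Proof. by move=> /bernstein_cvg[x fx]; rewrite (fcalc_eq fx). Qed.

Lemma fcalcD f g : tame f -> tame g ->
  fcalc (fun s => f s + g s) = fcalc f + fcalc g.
Proof.
move=> /fcalc_cvg cf /fcalc_cvg cg; apply: fcalc_eq.
rewrite (_ : bernstein^~ _ = fun k => bernstein k f + bernstein k g).
  exact: converges_add.
by apply/funext => k; apply: walk_scalarD.
Qed.

Lemma fcalcZ c f : tame f -> fcalc (fun s => c * f s) = c *: fcalc f.
Proof.
move=> /fcalc_cvg cf; apply: fcalc_eq.
rewrite (_ : bernstein^~ _ = fun k => c *: bernstein k f).
  exact: converges_scale.
by apply/funext => k; apply: walk_scalarZ.
Qed.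

Lemma fcalc_star f : tame f -> fcalc (fun s => (f s)^*) = star (fcalc f).
Proof.
move=> /fcalc_cvg cf; apply: fcalc_eq.
rewrite (_ : bernstein^~ _ = fun k => star (bernstein k f)).
  exact: converges_star.
by apply/funext => k; rewrite [RHS]walk_scalar_star.
Qed.

Lemma fcalcM f g : tame f -> tame g ->
  fcalc (fun s => f s * g s) = fcalc f * fcalc g.
Proof.
move=> tf tg; have [[B fB] _] := tf; have [_ gC] := tg.
have B0 : 0 <= B by rewrite -lecR; apply: le_trans (normr_ge0 _) (fB 0).
have cfg := converges_mul (fcalc_cvg tf) (fcalc_cvg tg).
suff c0 : converges (fun N => bernstein N (fun s => f s * g s)
    - bernstein N f * bernstein N g) 0.
  have := converges_add c0 cfg; rewrite add0r.
  by under eq_fun do rewrite subrK; apply: fcalc_eq.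
apply/converges_dist => e e0; have B1 : 0 < B + 1 by rewrite ltr_wpDl.
(* The error for equal lengths is at most 2 B (d + 4 C d'), and 4 C d' <= d, so it is at most 4 B d
   < e. *)
have d0 : 0 < e / (4 * (B + 1)) by rewrite divr_gt0 ?mulr_gt0.
have dB : 4 * B * (e / (4 * (B + 1))) = e - 4 * (e / (4 * (B + 1))).
  by field; rewrite gt_eqF.
move: (e / _) d0 dB => d d0 dB.
have [C C0 HC] := gC d d0; have C1 : 0 < C + 1 by rewrite ltr_wpDl.
have d1 : 0 < d / (4 * (C + 1)) by rewrite divr_gt0 ?mulr_gt0.
have dC : 4 * (C * (d / (4 * (C + 1)))) = d - 4 * (d / (4 * (C + 1))).
  by field; rewrite gt_eqF.
move: (_ / (4 * _)) d1 dC => d' d1 dC.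
have [N HN] := inv_succ_small d1; exists N => k /HN Nk; rewrite subr0 cnorm_distC.
apply: le_lt_trans (bernstein_mul_error _ _ (ltW d0) C0 fB HC) _.
move: (k.+1%:R^-1) (ltW Nk) => x xd; have Ck := ler_wpM2l C0 xd.
have : 2 * B * (d + 2 * C * (x + x)) <= 2 * B * (2 * d); last lra.
by apply: ler_wpM2l; [rewrite mulr_ge0|lra].
Qed.

End Calculus.

Section CalculusAtSquare.
Variables (R : realType) (A : cstarAlgType R) (h : A).
Hypotheses (star_h : star h = h) (h_le1 : cnorm h <= 1).

(** Applying [phi] exchanges the weights of the two steps, which reflects the walk by
    [walk_swap]. *)
Lemma fcalc_equivariant (phi : {lrmorphism A -> A}) (f : R -> R[i]) :
  star_preserving phi -> phi h = - h -> tame f ->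
  fcalc h (fun s => f (- s)) = phi (fcalc h f).
Proof.
move=> sphi oddh /(fcalc_cvg star_h h_le1) cf; apply: fcalc_eq.
rewrite (_ : (bernstein h)^~ _ = fun k => phi (bernstein h k f)).
  apply: cvg0_le cf => k; rewrite cnorm_ge0 /= -rmorphB.
  exact: star_hom_contractive.
have phiZ c x : phi (c *: x) = c *: phi x by apply: linearZ.
have phiD : phi (1 + h) = 1 - h by rewrite rmorphD; congr (_ + _); rewrite ?rmorph1.
have phiB : phi (1 - h) = 1 + h.
  rewrite rmorphB; congr (_ + _); first exact: rmorph1.
  exact: etrans (congr1 -%R oddh) (opprK h).
apply/funext => k; rewrite /bernstein /walk_scalar walk_hom !phiZ phiD phiB walk_swap.
by apply: eq_walk => p _ /=; rewrite phiZ rmorph1 mulNr opprK.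
Qed.

(** The average over N steps gives exactly h^2 + (1 - h^2) / N. *)
Lemma fcalc_square (f : R -> R[i]) :
  (forall s, `|s| <= 1 -> f s = (s ^+ 2)%:C) -> fcalc h f = h * h.
Proof.
move=> fE; apply: fcalc_eq; apply/converges_dist => e e0.
have C0 : 0 < cnorm (1 - h * h) + 1 by rewrite ltr_wpDl ?cnorm_ge0.
have [N HN] := inv_succ_small (divr_gt0 e0 C0); exists N => k /HN.
have -> : bernstein h k f - h * h = (k.+1%:R^-1)%:C *: (1 - h * h).
  rewrite /bernstein (eq_walk_scalar h
    (f2 := fun p => (k.+1%:R ^- 2)%:C * (p ^+ 2)%:C)); last first.
    move=> p pk; rewrite fE -?rmorphM; last first.
      by rewrite normrM normfV normr_nat ler_pdivrMr ?ltr0Sn // mul1r.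
    by congr _%:C; rewrite exprMn exprVn mulrC.
  rewrite walk_scalarZ walk_square_mean scalerDr !scalerA -!rmorphM.
  have : k.+1%:R != 0 :> R by rewrite pnatr_eq0.
  move: k.+1%:R => n n0.
  have -> : n ^- 2 * n = n^-1 by field.
  have -> : n ^- 2 * (n * (n - 1)) = 1 - n^-1 by field.
  by rewrite rmorphB rmorph1 scalerBl scale1r scalerBr; zmod.
rewrite cnormZr ger0_norm ?invr_ge0 ?ler0n // ltr_pdivlMr // => H.
apply: le_lt_trans H; rewrite mulrDr mulr1 lerDl invr_ge0 ler0n //.
Qed.

End CalculusAtSquare.

(** * Functions on the cone as functions on the line *)

Section TameProfiles.
Variable R : realType.
Implicit Types (f : R -> R[i]) (s t e d : R).

Definition clamp s : R := Num.max (- 1) (Num.min s 1).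

Lemma clamp_itv s : -1 <= clamp s <= 1.
Proof. by rewrite /clamp maxEle minEle; do 2 case: ifPn; rewrite -?ltNge => *; lra. Qed.

Lemma clamp_dist s t : (clamp s - clamp t) ^+ 2 <= (s - t) ^+ 2.
Proof.
wlog st : s t / s <= t.
  by move=> W; case: (lerP s t) => [/W//|/ltW/W]; rewrite -sqrrN opprB -[leRHS]sqrrN opprB.
rewrite -sqrrN opprB -[leRHS]sqrrN opprB.
have : 0 <= clamp t - clamp s <= t - s.
  by rewrite /clamp !maxEle !minEle; do 4 case: ifPn; rewrite -?ltNge => *; lra.
by move=> /andP[u0 uv]; rewrite lerXn2r // nnegrE; lra.
Qed.

(** Compactness in near-covering form, for C tending to infinity: the local thresholds [M] yield one
    global C. *)
Lemma compact_interval_bound (P : R -> R -> Prop) (a b : R) :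
  (forall x, a <= x <= b -> exists2 d, 0 < d & exists M, forall y C,
     a <= y <= b -> `|y - x| < d -> M < C -> P C y) ->
  exists2 C, 0 <= C & forall y, a <= y <= b -> P C y.
Proof.
move=> H; have /compact_near_coveringP/near_covering_withinP cov := @segment_compact R a b.
have [M [_ HM]] : \forall C \near pinfty_nbhs R, `[a, b] `<=` (fun y => P C y).
  apply: cov => x; rewrite /= in_itv /= => /H[d d0 [M HM]].
  exists (ball x d, [set C | M < C]) => /=.
    by split; [apply: nbhsx_ballx | exists M; split => //; apply: num_real].
  move=> [y C] /= [xy MC]; rewrite in_itv /= => yab; apply: HM => //.
  by rewrite distrC.
exists (`|M| + 1); first by rewrite addr_ge0.
move=> y yab; apply: HM; last by rewrite /= in_itv.
by rewrite ltr_pwDr // ler_norm.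
Qed.

Lemma tame_clamp f : (forall s, f s = f (clamp s)) ->
  (forall s e, -1 <= s <= 1 -> 0 < e -> exists2 d, 0 < d &
     forall t, -1 <= t <= 1 -> `|t - s| < d -> `|f t - f s| < e%:C) ->
  tame f.
Proof.
move=> fc cf.
have [B B0 fB] : exists2 B : R, 0 <= B & forall s, -1 <= s <= 1 -> `|f s| <= B%:C.
  apply: (compact_interval_bound (P := fun B s => `|f s| <= B%:C)) => s sI.
  have [d d0 Hd] := cf s 1 sI ltr01; exists d => //.
  have [M HM] : exists M : R, `|f s| <= M%:C.
    by exists (complex.Re `|f s|); rewrite normc_def.
  exists (M + 1) => t C tI ts MC; rewrite -(subrK (f s) (f t)).
  apply: le_trans (ler_normD _ _) _.
  apply: le_trans (lerD (ltW (Hd t tI ts)) HM) _.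
  by rewrite -rmorphD lecR addrC ltW.
split; first by exists B => s; rewrite fc fB // clamp_itv.
move=> e e0.
suff [C C0 HC] : exists2 C : R, 0 <= C & forall s, -1 <= s <= 1 ->
    forall t, -1 <= t <= 1 -> `|f s - f t| <= (e + C * (s - t) ^+ 2)%:C.
  exists C => // s t; rewrite (fc s) (fc t).
  apply: le_trans (HC _ (clamp_itv s) _ (clamp_itv t)) _.
  by rewrite lecR lerD2l ler_wpM2l // clamp_dist.
apply: (compact_interval_bound (P := fun C s => forall t, -1 <= t <= 1 ->
    `|f s - f t| <= (e + C * (s - t) ^+ 2)%:C)) => s sI.
have e2 : 0 < e / 2 by rewrite divr_gt0.
have [d d0 Hd] := cf s _ sI e2; exists (d / 2); first by rewrite divr_gt0.
(* If |y - t| >= d / 2, this threshold makes C (y - t)^2 at least 2 B. Otherwise y and t are both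
   within d of s, and the values differ by less than e. *)
exists (2 * B / (d / 2) ^+ 2) => y C yI ys MC t tI.
have d2 : 0 < (d / 2) ^+ 2 by rewrite exprn_gt0 // divr_gt0.
have C0 : 0 <= C by apply: le_trans (ltW MC); rewrite divr_ge0 ?mulr_ge0 // ltW.
case: (ltrP `|y - t| (d / 2)) => yt.
  have ts : `|t - s| < d.
    have := ler_normD (t - y) (y - s); rewrite addrA subrK [`|t - y|]distrC; lra.
  have ys' : `|y - s| < d by lra.
  rewrite -(subrK (f s) (f y)) -addrA; apply: le_trans (ler_normD _ _) _.
  rewrite [`|f s - f t|]distrC; apply: le_trans (lerD (ltW (Hd _ yI ys')) (ltW (Hd _ tI ts))) _.
  rewrite -rmorphD lecR; have : 0 <= C * (y - t) ^+ 2 by rewrite mulr_ge0 ?sqr_ge0.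
  lra.
apply: le_trans (ler_normB _ _) _; apply: le_trans (lerD (fB _ yI) (fB _ tI)) _.
rewrite -rmorphD lecR; move: MC; rewrite ltr_pdivrMr // => MC.
have : (d / 2) ^+ 2 <= (y - t) ^+ 2.
  rewrite -[leRHS]real_normK ?num_real // lerXn2r ?nnegrE //; lra.
by move=> /(ler_wpM2l C0); move: (C * _) (C * _) MC => x z; lra.
Qed.

End TameProfiles.

Section ConeProfile.
Variable R : realType.
Implicit Types (F H : cone_fun R 'Z_2) (s t e d : R).

(* Identifies (0,1] x Z/2 with [-1,1] minus 0 by (t, g) |-> (-1)^g sqrt t,
   extended to R by 0 at 0 and by constants outside [-1,1]; insub fails
   exactly at 0. *)
Definition cone_profile F s : R[i] :=
  oapp (fun t : half_open_interval R => F t (if s < 0 then 1%R else 0%R)) 0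
    (insub (Num.min (s ^+ 2) 1) : option (set_type `]0, 1]%classic)).

Lemma half_open_mem s : (s \in `]0, 1]%classic) = (0 < s <= 1).
Proof. by apply/idP/idP; rewrite inE /= in_itv. Qed.

Lemma min_sqr_in s : s != 0 -> Num.min (s ^+ 2) 1 \in `]0, 1]%classic.
Proof.
move=> s0; rewrite half_open_mem lt_min ltr01 andbT ge_min lexx orbT andbT.
by rewrite exprn_even_gt0.
Qed.

Lemma cone_profile0 F : cone_profile F 0 = 0.
Proof.
by rewrite /cone_profile insubN // half_open_mem lt_min expr0n ltxx.
Qed.

Definition sqr_point s (s0 : s != 0) : half_open_interval R :=
  exist (fun t => t \in `]0, 1]%classic) _ (min_sqr_in s0).

Lemma cone_profile_some F s (s0 : s != 0) :
  cone_profile F s = F (sqr_point s0) (if s < 0 then 1%R else 0%R).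
Proof.
rewrite /cone_profile insubT ?min_sqr_in// => m /=; congr (F _ _).
by apply: val_inj; rewrite SubK.
Qed.

Lemma cone_profile_clamp F s : cone_profile F s = cone_profile F (clamp s).
Proof.
have [neg sqr] : (clamp s < 0) = (s < 0) /\
    Num.min (clamp s ^+ 2) 1 = Num.min (s ^+ 2) 1.
  rewrite /clamp maxEle !minEle; split.
    by do 2 case: ifPn; rewrite -?ltNge => *; apply/idP/idP; lra.
  by do ! case: ifPn; rewrite -?ltNge => *; nra.
by rewrite /cone_profile neg sqr.
Qed.

Lemma cone_profile_translate F s :
  cone_profile (cone_translate (1%R : 'Z_2) F) s = cone_profile F (- s).
Proof.
have [->|s0] := eqVneq s 0; first by rewrite oppr0 !cone_profile0.
rewrite /cone_profile /cone_translate sqrrN oppr_lt0.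
case: insub => //= t; congr (F t _); apply/val_inj.
by case: (ltgtP s 0) s0.
Qed.

Section Continuity.
Variable phi : half_open_interval R -> R[i].
Hypothesis C0_phi : C0 phi.
Let v (t : half_open_interval R) : R := set_val t.

(** Open sets of [half_open_interval] are preimages of open sets of R, so balls of R suffice. *)
Lemma C0_eps_delta (t0 : half_open_interval R) e : 0 < e ->
  exists2 d : R, 0 < d & forall t : half_open_interval R,
    `|v t - v t0| < d -> `|phi t - phi t0| < e%:C.
Proof.
move=> e0; have [cphi _] := C0_phi.
have e0' : 0 < e%:C :> R[i] by rewrite ltcR.
have : nbhs t0 (fun x => `|phi t0 - phi x| < e%:C).
  by have /cvgrPdist_lt := cphi t0; apply.
rewrite nbhsE => -[U [[W oW WU] Ut0] UP].
have Wt0 : W (v t0) by move: Ut0; rewrite -WU.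
have /nbhs_ballP[d d0 dW] : nbhs (v t0) W by apply: open_nbhs_nbhs.
exists d => // t td; rewrite distrC; apply: UP; rewrite -WU; apply: dW.
by rewrite /ball /= distrC.
Qed.

(** The compact set outside which [phi] is small has a closed image in R that misses 0, hence misses
    a ball around 0. *)
Lemma C0_small e : 0 < e ->
  exists2 d : R, 0 < d & forall t : half_open_interval R, v t < d -> `|phi t| < e%:C.
Proof.
move=> e0; have [_ /(_ e e0)[K cK HK]] := C0_phi.
have cvK : compact (v @` K).
  by apply: continuous_compact => //; apply: continuous_subspaceT; apply: initial_continuous.
have clK := compact_closed (@Rhausdorff R) cvK.
have nK : (~` (v @` K)) 0.
  move=> [[x /= xI] _]; rewrite /v set_valE /= => x0; move: xI.
  by rewrite x0 half_open_mem ltxx.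
have /nbhs_ballP[d d0 dK] : nbhs (0 : R) (~` (v @` K)).
  by apply: open_nbhs_nbhs; split => //; apply: closed_openC.
exists d => // t td; apply: HK => Kt; apply: (dK (v t)); last by exists t.
have : 0 < v t.
  rewrite /v set_valE; case: (t) => x xI /=.
  by have /[!half_open_mem]/andP[] := xI.
by move=> t0; rewrite /ball /= sub0r normrN gtr0_norm.
Qed.

End Continuity.

Lemma cone_profile_tame F : in_cone F -> tame (cone_profile F).
Proof.
move=> cF; apply: tame_clamp; first exact: cone_profile_clamp.
move=> s e sI e0; have [->|s0] := eqVneq s 0.
  have [d0 d0_gt0 H0] := C0_small (cF 0) e0.
  have [d1 d1_gt0 H1] := C0_small (cF 1) e0.
  exists (Num.min 1 (Num.min d0 d1)); first by rewrite !lt_min ltr01 d0_gt0.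
  move=> t _; rewrite subr0 cone_profile0 subr0 !lt_min => /and3P[t1 td0 td1].
  have [->|t0] := eqVneq t 0; first by rewrite cone_profile0 normr0 ltcR.
  (* As |t| < 1, the point t^2 of the cone is at least as close to 0 as t. *)
  have tt : Num.min (t ^+ 2) 1 <= `|t|.
    rewrite ge_min -(real_normK (num_real t)); apply/orP; left.
    by rewrite expr2 ler_piMr // ltW.
  rewrite cone_profile_some; case: ifP => _; [apply: H1|apply: H0];
    by rewrite set_valE /= (le_lt_trans tt).
have [d d_gt0 Hd] := @C0_eps_delta _ (cF (if s < 0 then 1%R else 0%R))
  (sqr_point s0) e e0.
(* The first bound preserves the sign, hence the group element. The second suffices because |t^2 -
   s^2| <= 2 |t - s| on [-1, 1]. *)
exists (Num.min `|s| (d / 2)); first by rewrite lt_min normr_gt0 s0 divr_gt0.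
move=> t tI; rewrite lt_min => /andP[ts td].
have sgn : (t < 0) = (s < 0).
  move: ts; case: (ltrP s 0) => s00.
    rewrite (ltr0_norm s00) ltr_norml => /andP[??]; apply/idP; lra.
  rewrite (ger0_norm s00) ltr_norml => /andP[??]; apply/negbTE; rewrite -leNgt; lra.
have t0 : t != 0.
  by apply: contraTneq ts => ->; rewrite sub0r normrN ltxx.
rewrite !cone_profile_some sgn; apply: Hd; rewrite !set_valE /=.
have sqr_le1 (x : R) : -1 <= x <= 1 -> Num.min (x ^+ 2) 1 = x ^+ 2.
  by move=> xI; apply/min_idPl; nra.
rewrite !sqr_le1 // subr_sqr normrM.
have : `|t + s| <= 2 by rewrite ler_norml; lra.
move: td; rewrite ltr_pdivlMr // => td ts2.
by apply: le_lt_trans (ler_wpM2l (normr_ge0 _) ts2) _.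
Qed.

End ConeProfile.

(** * Trivializations from odd elements *)

Section Trivialization.
Variables (R : realType) (A : cstarAlgType R) (alpha : cstar_action 'Z_2 A).

Lemma odd_equivariant_cone_hom (h : A) : star h = h -> cnorm h <= 1 ->
  alpha (1%R : 'Z_2) h = - h ->
  equivariant_cone_hom alpha (fun F => fcalc h (cone_profile F)).
Proof.
move=> sh h1 oddh.
have ext (f g : R -> R[i]) : f =1 g -> fcalc h f = fcalc h g.
  by move=> /funext ->.
split.
- move=> F H /cone_profile_tame tF /cone_profile_tame tH.
  (* Operations on profiles are pointwise; where [insub] fails, the default 0 must satisfy the
     identity too. *)
  rewrite -fcalcD //; apply: ext => s; rewrite /cone_profile.
  by case: insub => //=; rewrite addr0.
- move=> c F /cone_profile_tame tF.
  rewrite -fcalcZ //; apply: ext => s; rewrite /cone_profile.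
  by case: insub => //=; rewrite mulr0.
- move=> F H /cone_profile_tame tF /cone_profile_tame tH.
  rewrite -fcalcM //; apply: ext => s; rewrite /cone_profile.
  by case: insub => //=; rewrite mulr0.
- move=> F /cone_profile_tame tF.
  rewrite -fcalc_star //; apply: ext => s; rewrite /cone_profile.
  by case: insub => //=; rewrite rmorph0.
move=> g F /cone_profile_tame tF.
have [->|->] : g = 0%R \/ g = 1%R.
  by case: g => [[|[|//]] i]; [left|right]; apply/val_inj.
  have -> : cone_translate (0%R : 'Z_2) F = F.
    apply/funext => t; apply/funext => k; congr (F t _); exact: mulg1.
  by rewrite [RHS](act_one alpha).
rewrite -(fcalc_equivariant sh h1 (act_star alpha _) oddh tF).
by apply: ext => s; apply: cone_profile_translate.
Qed.

(** On [-1, 1] the cone coordinate attached to s is s^2. *)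
Lemma fcalc_cone_t1 (h : A) : fcalc h (cone_profile (@cone_t1 R 'Z_2)) = h * h.
Proof.
apply: fcalc_square => s s1; have [->|s0] := eqVneq s 0.
  by rewrite cone_profile0 expr0n.
rewrite cone_profile_some /cone_t1 set_valE /=; congr _%:C; apply/min_idPl.
by rewrite -real_normK ?num_real // expr_le1.
Qed.

(* Sums of squares are positive, so each h i has norm at most 1. *)
Lemma LT_trivializable_of_odd m (h : 'I_m.+1 -> A) :
  (forall i, star (h i) = h i) -> (forall i, alpha (1%R : 'Z_2) (h i) = - h i) ->
  \sum_i h i * h i = 1 -> LT_trivializable alpha m.
Proof.
move=> sh oddh sum1; exists (fun i F => fcalc (h i) (cone_profile F)); split.
  move=> i; apply: odd_equivariant_cone_hom => //.
  have : cnorm (h i * h i) <= cnorm (1 : A).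
    apply: cnorm_mono; first exact: cpositive_sqr.
    rewrite -sum1 (bigD1 i) //= addrAC subrr add0r.
    by apply: cpositive_sum => j _; apply: cpositive_sqr.
  by rewrite cnorm_sqr // cnorm1 expr_le1 // cnorm_ge0.
by rewrite -sum1; apply: eq_bigr => i _; apply: fcalc_cone_t1.
Qed.

Lemma dimLT_le m : LT_trivializable alpha m -> (dimLT alpha <= m%:R%:E)%E.
Proof.
move=> Hm; rewrite /dimLT; case: pselect => [ex|[]]; last by exists m; apply/asboolP.
case: ex_minnP => k _ /(_ m); rewrite lee_fin ler_nat; apply; exact/asboolP.
Qed.

End Trivialization.

(** * Weighted real and imaginary parts of the sphere generators *)

Section Sphere.
Variables (R : realType) (n : nat) (q : R) (A : cstarAlgType R) (z : 'I_n -> A).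
Hypothesis relz : sphere_relations q z.

(** Then 1 - r = (1 + q^2) / 2, and the weights are c_i = (1 - r)^i. *)
Let r : R := (1 - q ^+ 2) / 2.

Lemma sphere_weight_gt0 : 0 < 1 - r.
Proof. by rewrite /r; nra. Qed.

Lemma sphere_weight_sum j : (1 - r) ^+ j + r * \sum_(i < j) (1 - r) ^+ i = 1.
Proof.
elim: j => [|j IH]; first by rewrite expr0 big_ord0 mulr0 addr0.
by rewrite big_ord_recr /= -[RHS]IH exprS; ring.
Qed.

(** By [sphere_starzz] every term becomes a combination of the [z j * star (z j)]. After exchanging
    sums, the coefficient for j is c_j + r sum_(i < j) c_i = 1, and [sphere_sum] concludes. *)
Lemma sphere_weighted_sum :
  \sum_(i < n) ((1 - r) ^+ i / 2)%:C *: (z i * star (z i) + star (z i) * z i) = 1.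
Proof.
pose c k : R := (1 - r) ^+ k; pose P i := z i * star (z i).
transitivity (\sum_(i < n) ((c i)%:C *: P i
    + \sum_(j < n | (i < j)%N) (r * c i)%:C *: P j)).
  apply: eq_bigr => i _; rewrite (sphere_starzz relz) -/(P i) addrA scalerDr.
  congr (_ + _).
    rewrite scalerDr -scalerDl -rmorphD; congr (_%:C *: _); rewrite -/(c i); lra.
  rewrite scalerA -rmorphM scaler_sumr; apply: eq_bigr => j _.
  by congr (_%:C *: _); rewrite /r -/(c i); lra.
rewrite big_split /= (exchange_big_dep xpredT) //= -big_split /=.
rewrite -(sphere_sum relz); apply: eq_bigr => j _.
rewrite -scaler_suml -scalerDl -rmorph_sum -rmorphD -mulr_sumr.
rewrite -(big_ord_widen n c (ltnW (ltn_ord j))) sphere_weight_sum.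
by rewrite rmorph1 scale1r.
Qed.

Let re (i : 'I_n) : A := (Num.sqrt ((1 - r) ^+ i) / 2)%:C *: (z i + star (z i)).
(** Minus the usual imaginary part, up to scaling; the sign affects neither self-adjointness,
    oddness nor the square. *)
Let im (i : 'I_n) : A := (Num.sqrt ((1 - r) ^+ i) / 2)%:C *: ('i *: (z i - star (z i))).

(** As ['i] squares to -1, the squares of [z i] and [star (z i)] cancel and the mixed products
    double. *)
Lemma sphere_re_im_sqr i : re i * re i + im i * im i
  = ((1 - r) ^+ i / 2)%:C *: (z i * star (z i) + star (z i) * z i).
Proof.
rewrite /re /im; set c := (1 - r) ^+ i.
have c0 : 0 <= c by rewrite exprn_ge0 // ltW // sphere_weight_gt0.
have E : Num.sqrt c / 2 * (Num.sqrt c / 2) = c / 4.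
  by rewrite mulrACA -expr2 sqr_sqrtr //; congr (_ * _); field.
have sqrZ x (e : R[i]) : (e *: x) * (e *: x) = (e * e) *: (x * x) :> A.
  by rewrite -scalerAl -scalerAr scalerA.
rewrite !sqrZ mulCii scaleN1r -rmorphM E -scalerDr.
have -> : (z i + star (z i)) * (z i + star (z i)) - (z i - star (z i)) * (z i - star (z i))
    = (z i * star (z i) + star (z i) * z i) + (z i * star (z i) + star (z i) * z i).
  by rewrite !mulrDl !mulrDr !mulNr !mulrN; zmod.
by rewrite scalerDr -scalerDl -rmorphD; congr (_%:C *: _); field.
Qed.

Lemma sphere_trivializable (alpha : cstar_action 'Z_2 A) m :
  is_antipodal z alpha -> (n + n)%N = m.+1 -> LT_trivializable alpha m.
Proof.
move=> odd_z nm.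
have odd_star i : alpha (1%R : 'Z_2) (star (z i)) = - star (z i).
  by rewrite act_star odd_z starN.
pose h (k : 'I_(n + n)) := match fintype.split k with inl i => re i | inr i => im i end.
have star_h k : star (h k) = h k.
  rewrite /h; case: fintype.split => i; rewrite /re /im starZr; congr (_ *: _).
    by rewrite starD starK addrC.
  by rewrite starZ starB starK conjCi scaleNr -scalerN opprB.
have odd_h k : alpha (1%R : 'Z_2) (h k) = - h k.
  have aZ c x : alpha (1%R : 'Z_2) (c *: x) = c *: alpha (1%R : 'Z_2) x.
    exact: linearZ.
  rewrite /h; case: fintype.split => i; rewrite /re /im !aZ -!scalerN; congr (_ *: _).
    by rewrite rmorphD [X in X + _]odd_z [X in _ + X]odd_star opprD.
  by congr (_ *: _); rewrite rmorphB [X in X - _]odd_z [X in _ - X]odd_star opprD.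
have sum_h : \sum_k h k * h k = 1.
  rewrite big_split_ord /= -big_split /= -[RHS]sphere_weighted_sum.
  apply: eq_bigr => i _; rewrite -sphere_re_im_sqr /h.
  by rewrite (fintype.unsplitK (inl i)) (fintype.unsplitK (inr i)).
(* Generalizing over [h] first lets its index type be rewritten to ['I_m.+1] without a cast. *)
move: h star_h odd_h sum_h; rewrite nm => h; exact: LT_trivializable_of_odd.
Qed.

End Sphere.

Theorem proposition5p14 (R : realType) (n : nat) (hn : (1 <= n)%N)
  (q : R) (hq0 : 0 < q) (hq1 : q < 1)
  (A : cstarAlgType R) (z : 'I_n -> A) (hA : is_quantum_sphere q z)
  (alpha : cstar_action 'Z_2 A) (halpha : is_antipodal z alpha) :
  (dimLT alpha <= (2 * n - 1)%:R%:E)%E.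
Proof.
apply: dimLT_le; apply: (sphere_trivializable hA.1 halpha).
(* As n >= 1, the truncated subtraction is exact and 2 n is the successor of 2 n - 1. *)
by rewrite mul2n -addnn; case: n hn {z hA halpha} => // n _; rewrite subn1.
Qed.
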